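(* Let $N\in\mathbb{N}$, $N\ge 1$, let $J=\frac{(N+1)(N+2)}{2}$, and let $\{P_j^{(N)}=(\rho_j^{(N)},\theta_j^{(N)})\}_{j=1}^{J}$ be a set of regular points in the unit disk. Then the set of kernel polynomials $$\{K_N(r,\phi;\rho_j^{(N)},\theta_j^{(N)})\}_{j=1}^{J}$$ is a basis of $V_N$. Consequently, the set of scaling functions $\{\phi_{N,j}(r,\phi)\}_{j=1}^{J}$, where $\phi_{N,j}(r,\phi):=K_N(r,\phi;\rho_j^{(N)},\theta_j^{(N)})$, is a basis of $V_N$.
   Context: Points of the closed unit disk $B(0,1)=\{(x,y)\in\mathbb{R}^2: x^2+y^2\le 1\}$ are written in polar coordinates $(r,\phi)$, $0\le r\le 1$, $0\le\phi<2\pi$. $V_N$ is the complex vector space of all polynomials in two variables $x,y$ of total degree at most $N$, regarded as functions on $B(0,1)$; its dimension is $J=\frac{(N+1)(N+2)}{2}$. Zernike polynomials: for $n\in\mathbb{N}_0=\{0,1,2,\dots\}$ and $m\in\mathbb{Z}$ with $|m|\le n$ and $n-m$ even, $$Z_n^m(r,\phi)=\sqrt{\tfrac{n+1}{\pi}}\;R_n^{|m|}(r)\,e^{im\phi},\qquad R_n^{|m|}(r)=\sum_{s=0}^{(n-|m|)/2}\frac{(-1)^s(n-s)!}{s!\,\big(\frac{n+|m|}{2}-s\big)!\,\big(\frac{n-|m|}{2}-s\big)!}\,r^{n-2s}.$$ Kernel polynomial with parameter $(\rho,\theta)$: $$K_N(r,\phi;\rho,\theta)=\sum_{n=0}^{N}\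 \sum_{\substack{m=-n\\ n-m\ \mathrm{even}}}^{n}\overline{Z_n^m(\rho,\theta)}\,Z_n^m(r,\phi).$$ Regular points: given $N$, set $k=\lfloor N/2\rfloor+1$. Take radii $1>\lambda_1>\lambda_2>\cdots>\lambda_k\ge 0$ given by $\lambda_i=1.1565\,\zeta_i-0.76535\,\zeta_i^2+0.60517\,\zeta_i^3$, where $\zeta_i=\cos\frac{(2i-1)\pi}{2(N+1)}$, $1\le i\le k$. On the circle of radius $\lambda_i$ centered at the origin choose $n_i=2N+5-4i$ equally spaced points, $1\le i\le k$ (if $\lambda_k=0$, which happens for $N$ even, then $n_k=1$ and the point is the origin). This gives in total $J=\frac{(N+1)(N+2)}{2}$ points, and such a set is called a set of regular points. *)

(* Defs.v *)
From mathcomp Require Import all_boot all_order all_algebra.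
From mathcomp Require Import boolp classical_sets functions reals.
From mathcomp Require Import topology normedtype trigo.
From mathcomp Require Import complex.
From mathcomp Require mpoly.
(* the notations of [mpoly] clash with those of [classical_sets] *)
Import -(notations) mpoly.

Set Implicit Arguments.
Unset Strict Implicit.
Unset Printing Implicit Defensive.
Import Order.TTheory GRing.Theory Num.Theory.
Local Open Scope classical_set_scope.
Local Open Scope ring_scope.
Local Open Scope complex_scope.

Definition is_basis (K : fieldType) (V : lmodType K) (W : set V)
    (J : nat) (b : 'I_J -> V) : Prop :=
  [/\ forall j, W (b j),
      forall c : 'I_J -> K, \sum_(j < J) c j *: b j = 0 -> forall j, c j = 0
    & forall v, W v -> exists c : 'I_J -> K, v = \sum_(j < J) c j *: b j].

Definition disk (R : realType) : Type :=
  {p : R * R | p.1 ^+ 2 + p.2 ^+ 2 <= 1}.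

Definition cartesian (R : realType) (r phi : R) : R * R :=
  (r * cos phi, r * sin phi).

Definition polar_radius (R : realType) (p : R * R) : R :=
  Num.sqrt (p.1 ^+ 2 + p.2 ^+ 2).

(* The angle of the origin is an unspecified element of [0, 2 pi[; the
   functions considered below do not depend on it, because the radial
   polynomial of a nonzero order m vanishes at r = 0. *)
Definition polar_angle (R : realType) (p : R * R) : R :=
  xget 0 [set phi | 0 <= phi < 2 * pi /\ p = cartesian (polar_radius p) phi].

Definition on_disk (R : realType) (F : R -> R -> R[i]) : disk R -> R[i]^o :=
  fun p => F (polar_radius (sval p)) (polar_angle (sval p)).

(* [mpoly.msize q] is one more than the total degree of [q]. *)
Definition VN (R : realType) (N : nat) : set (disk R -> R[i]^o) :=
  [set f | exists2 q : mpoly.mpoly 2 R[i], (mpoly.msize q <= N.+1)%N &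
     forall p : disk R,
       f p = mpoly.meval
               (fun k : 'I_2 => (if k == 0 then (sval p).1 else (sval p).2)%:C)
               q].
Arguments VN : clear implicits.

Definition expi (R : realType) (t : R) : R[i] := cos t +i* sin t.

(* To be used for a <= n and n - a even. *)
Definition radial (R : realType) (n a : nat) (r : R) : R :=
  \sum_(s < ((n - a)./2).+1)
    (-1) ^+ s * ((n - s)`!)%:R
    / (s`! * ((n + a)./2 - s)`! * ((n - a)./2 - s)`!)%:R
    * r ^+ (n - 2 * s).

Definition zernike (R : realType) (n : nat) (m : int) (r phi : R) : R[i] :=
  (Num.sqrt (n.+1%:R / pi) * radial n `|m|%N r)%:C * expi (m%:~R * phi).

(* The integers -n, ..., n. *)
Definition sym_range (n : nat) : seq int :=
  [seq k%:Z - n%:Z | k <- iota 0 n.*2.+1].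

Definition kernel_poly (R : realType) (N : nat) (r phi rho theta : R) : R[i] :=
  \sum_(0 <= n < N.+1) \sum_(m <- sym_range n | (2 %| n%:Z - m)%Z)
    (zernike n m rho theta)^* * zernike n m r phi.

Definition nb_circles (N : nat) : nat := (N %/ 2).+1.

Definition nb_points (N i : nat) : nat := 2 * N + 5 - 4 * i.

Definition zeta (R : realType) (N i : nat) : R :=
  cos ((2 * i%:R - 1) * pi / (2 * (N%:R + 1))).

(* The coefficients are 1.1565, 0.76535 and 0.60517, written so as to avoid
   large unary literals. *)
Definition lambda (R : realType) (N i : nat) : R :=
  (1 + 156 / 10 ^+ 3 + 5 / 10 ^+ 4) * zeta R N i
  - (765 / 10 ^+ 3 + 35 / 10 ^+ 5) * zeta R N i ^+ 2
  + (605 / 10 ^+ 3 + 17 / 10 ^+ 5) * zeta R N i ^+ 3.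

(* On each circle the position of the first point, given by [alpha], is
   free. *)
Definition regular_set (R : realType) (N : nat) (alpha : nat -> R)
    : set (R * R) :=
  [set p | exists i l : nat,
     [/\ (1 <= i <= nb_circles N)%N, (l < nb_points N i)%N &
         p = cartesian (lambda R N i)
               (alpha i + 2 * pi * l%:R / (nb_points N i)%:R)]].

(* The points with polar coordinates (rho j, theta j) enumerate, without
   repetition, a set of regular points. *)
Definition regular_points (R : realType) (N J : nat) (rho theta : 'I_J -> R)
    : Prop :=
  [/\ forall j, 0 <= rho j <= 1,
      forall j, 0 <= theta j < 2 * pi,
      injective (fun j => cartesian (rho j) (theta j))
    & exists alpha : nat -> R,
        range (fun j => cartesian (rho j) (theta j)) = regular_set N alpha].

Definition scaling_fun (R : realType) (N J : nat) (rho theta : 'I_J -> R)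
    (j : 'I_J) (r phi : R) : R[i] :=
  kernel_poly N r phi (rho j) (theta j).

(* Main.v *)
(* A function of V_N is f(r, phi) = \sum_m r^|m| q_m(r^2) e^(i m phi) with
   deg q_m <= (N - |m|)/2.  If f vanishes at the regular points, then on the
   outermost circle it is a trigonometric polynomial of degree N with 2 N + 1
   zeros, so every q_m has the root lambda_1^2.  Each further circle adds one
   root to every q_m; after t circles the q_m with |m| > N - 2 t are zero, so the
   2 (N - 2 t) + 1 points of the next circle again suffice.  In the end f = 0, and
   since the q_m of the Zernike polynomials of a given order have distinct
   degrees, the square matrix (Z_n^m(P_j)) is invertible.
   If \sum_j c_j K_N(.; P_j) = 0, its coefficients \sum_j c_j conj(Z_n^m(P_j)) on
   the Zernike polynomials vanish, because the function vanishes at the P_j;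
   hence c = 0.  The J independent kernels lie in the span of the J monomials
   x^a y^b, a + b <= N, hence they span it. *)

Require Import Defs.
From mathcomp Require Import all_boot all_order all_algebra.
From mathcomp Require Import boolp classical_sets functions reals.
From mathcomp Require Import topology normedtype trigo.
From mathcomp Require Import complex.
From mathcomp Require Import zify ring lra.
From mathcomp Require mpoly.
Import -(notations) mpoly.

Set Implicit Arguments.
Unset Strict Implicit.
Unset Printing Implicit Defensive.
Import Order.TTheory GRing.Theory Num.Theory.
Local Open Scope classical_set_scope.
Local Open Scope ring_scope.
Local Open Scope complex_scope.

(** * Linear algebra and interpolation on concentric circles *)

(** A trivial left kernel makes the square matrix row-free, hence invertible. Serves both for the
    Zernike values at the points and for the monomial coefficients of the kernels. *)
Lemma left_injective_two_sided_inverse (K : fieldType) (I J : finType)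
    (A : I -> J -> K) :
  #|I| = #|J| ->
  (forall v : I -> K, (forall j, \sum_i v i * A i j = 0) -> forall i, v i = 0) ->
  exists B : J -> I -> K,
    (forall i i', \sum_j A i j * B j i' = (i == i')%:R) /\
    (forall j j', \sum_i B j i * A i j' = (j == j')%:R).
Proof.
move=> eqIJ injA.
pose M : 'M[K]_(#|I|) :=
  \matrix_(i, j) A (enum_val i) (enum_val (cast_ord eqIJ j)).
have rankJ (j : J) : enum_val (cast_ord eqIJ (cast_ord (esym eqIJ) (enum_rank j))) = j.
  by rewrite cast_ordKV enum_rankK.
have sumJ (G : J -> K) :
    \sum_j G j = \sum_(j < #|I|) G (enum_val (cast_ord eqIJ j)).
  rewrite (reindex (fun j : 'I_#|I| => enum_val (cast_ord eqIJ j))) //=.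
  exists (fun j => cast_ord (esym eqIJ) (enum_rank j)) => j _ //.
  by rewrite enum_valK cast_ordK.
have sumI (G : I -> K) : \sum_i G i = \sum_(i < #|I|) G (enum_val i).
  by rewrite (reindex_onto enum_val enum_rank) => [|i _]; rewrite ?enum_rankK //;
     apply: eq_bigl => i; rewrite enum_valK eqxx.
have unitM : M \in unitmx.
  rewrite -row_free_unit -kermx_eq0; apply/eqP/row_matrixP => k.
  have : row k (kermx M) *m M = 0 by rewrite -row_mul mulmx_ker row0.
  move: (row k (kermx M)) => u uM; rewrite row0.
  apply/rowP => i; rewrite mxE -(enum_valK i).
  apply: (injA (fun i => u 0 (enum_rank i))) => j.
  have /rowP/(_ (cast_ord (esym eqIJ) (enum_rank j))) := uM.
  rewrite !mxE => e; rewrite -[RHS]e sumI; apply: eq_bigr => i' _.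
  by rewrite enum_valK mxE rankJ.
pose B j i := invmx M (cast_ord (esym eqIJ) (enum_rank j)) (enum_rank i).
have Mval i j : A i j = M (enum_rank i) (cast_ord (esym eqIJ) (enum_rank j)).
  by rewrite mxE enum_rankK rankJ.
exists B; split=> [i i'|j j'].
  have /matrixP/(_ (enum_rank i) (enum_rank i')) := mulmxV unitM.
  rewrite !mxE (inj_eq enum_rank_inj) => <-; rewrite sumJ.
  by apply: eq_bigr => k _; rewrite /B Mval enum_valK cast_ordK.
have /matrixP/(_ (cast_ord (esym eqIJ) (enum_rank j))
                 (cast_ord (esym eqIJ) (enum_rank j'))) := mulVmx unitM.
rewrite !mxE (inj_eq (@cast_ord_inj _ _ _)) (inj_eq enum_rank_inj) => <-.
rewrite sumI. by apply: eq_bigr => k _; rewrite /B Mval enum_valK.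
Qed.

(** Among the terms with [v p != 0], nothing can cancel the leading coefficient of the one of
    largest size. *)
Lemma distinct_sizes_free (K : idomainType) (I : finType) (P : pred I)
    (Q : I -> {poly K}) (v : I -> K) :
  (forall p, P p -> Q p != 0) ->
  {in P &, injective (fun p => size (Q p))} ->
  \sum_(p | P p) v p *: Q p = 0 -> forall p, P p -> v p = 0.
Proof.
move=> Qn0 Qinj sum0 p0 Pp0; apply/eqP/negPn/negP => vp0.
have := @arg_maxnP _ p0 (fun p => P p && (v p != 0)) (fun p => size (Q p)).
case=> [|p /andP[Pp vp] pmax]; first by rewrite Pp0 vp0.
have := congr1 (fun q : {poly K} => q`_(size (Q p)).-1) sum0.
rewrite coef0 coef_sum (bigD1 p) //= big1 => [|q /andP[Pq qp]].
  rewrite addr0 coefZ => /eqP; rewrite mulf_eq0 (negPf vp) /=.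
  by rewrite -/(lead_coef _) lead_coef_eq0 (negPf (Qn0 _ Pp)).
rewrite coefZ; have [->|vq] := eqVneq (v q) 0; first by rewrite mul0r.
rewrite nth_default ?mulr0 //.
have le_qp : (size (Q q) <= size (Q p))%N by apply: pmax; rewrite Pq vq.
have ne_qp : size (Q q) != size (Q p).
  by apply: contra_neq qp => /Qinj ->.
by rewrite -ltnS prednK ?size_poly_gt0 ?Qn0 // ltn_neqAle ne_qp.
Qed.

(** The polynomial with coefficients [c k] has size at most [n] and the [n] distinct roots [w l]. *)
Lemma vandermonde_free (K : idomainType) (n : nat) (c w : nat -> K) :
  {in gtn n &, injective w} ->
  (forall l, (l < n)%N -> \sum_(k < n) c k * w l ^+ k = 0) ->
  forall k, (k < n)%N -> c k = 0.
Proof.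
move=> winj c0 k kn; pose p := \poly_(i < n) c i.
suff p0 : p = 0 by have := coef_poly n c k; rewrite -/p p0 coef0 kn => <-.
apply/eqP/negPn/negP => pn0.
have := @max_poly_roots _ p [seq w l | l <- iota 0 n] pn0.
rewrite size_map size_iota ltnNge size_poly => H.
suff: false by [].
apply: H.
  apply/allP => y /mapP[l]; rewrite mem_iota add0n => /= ln ->.
  by rewrite rootE horner_poly c0.
rewrite map_inj_in_uniq ?iota_uniq // => l l'.
by rewrite !mem_iota !add0n => /= ln ln'; apply: winj.
Qed.

(* [Q M] carries the angular frequency M - N (all frequencies are shifted by N
   to stay in nat), and [w t] lists the points of the circle of radius [x t],
   counted from the outermost one. *)
Lemma circles_unisolvent (K : fieldType) (N : nat) (Q : nat -> {poly K})
    (x : nat -> K) (w : nat -> nat -> K) :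
  (forall M, (M <= N.*2)%N -> (size (Q M) <= ((N - `|M - N|)./2).+1)%N) ->
  {in [pred t | t.*2 <= N]%N &, injective (fun t => x t ^+ 2)} ->
  (forall t, (t.*2 < N)%N -> x t != 0) ->
  (forall t, (t.*2 <= N)%N ->
     {in gtn (N.*2.+1 - t.*2.*2)%N &, injective (w t)}) ->
  (forall t l, w t l != 0) ->
  (forall t l, (t.*2 <= N)%N -> (l < N.*2.+1 - t.*2.*2)%N ->
     \sum_(M < N.*2.+1) (Q M).[x t ^+ 2] * x t ^+ `|M - N| * w t l ^+ M = 0) ->
  forall M, (M <= N.*2)%N -> Q M = 0.
Proof.
move=> sQ xinj xn0 winj wn0 vanish.
(* After t circles, the frequencies beyond N - 2 t have been killed. *)
have few_roots t M : (t.*2 <= N.+2)%N -> (M <= N.*2)%N ->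
    (N - `|M - N| < t.*2)%N ->
    (forall s, (s < t)%N -> (Q M).[x s ^+ 2] = 0) -> Q M = 0.
  move=> tN MN dt roots; apply/eqP/negPn/negP => Qn0.
  have := @max_poly_roots _ (Q M) [seq x s ^+ 2 | s <- iota 0 t] Qn0.
  rewrite size_map size_iota => H.
  suff: (t < size (Q M))%N by have := sQ M MN; lia.
  apply: H.
    apply/allP => y /mapP[s]; rewrite mem_iota add0n => /= st ->.
    by rewrite rootE roots.
  rewrite map_inj_in_uniq ?iota_uniq // => s s'.
  by rewrite !mem_iota !add0n => /= ss ss'; apply: xinj; rewrite inE; lia.
(* Induction on the number [t] of circles used so far, at most [N./2 + 1]. *)
have all_roots t : (t.*2 <= N.+2)%N ->
    forall M s, (M <= N.*2)%N -> (s < t)%N -> (Q M).[x s ^+ 2] = 0.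
  elim: t => // t IH tN M s MN.
  have {}IH := IH (leq_trans (leqW (leqnSn _)) tN).
  rewrite ltnS leq_eqVlt => /orP[/eqP {s}->|]; last exact: IH.
  have [dt|dt] := ltnP (N - `|M - N|) t.*2.
    rewrite (few_roots t M) ?horner0 //; first by lia.
    by move=> s st; apply: IH.
  (* The frequencies left run from [2 t] to [2 N - 2 t]: as many as the circle has points. *)
  pose c k := (Q (t.*2 + k)%N).[x t ^+ 2] * x t ^+ `|(t.*2 + k)%N - N|.
  have cM : c (M - t.*2)%N = 0.
    apply: (@vandermonde_free _ (N.*2.+1 - t.*2.*2) c (w t)); last by lia.
      by apply: winj; lia.
    (* Factoring out [w t l ^+ t.*2] leaves a Vandermonde sum. *)
    move=> l ln; apply: (mulfI (expf_neq0 t.*2 (wn0 t l))); rewrite mulr0.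
    rewrite -[RHS](vanish t l _ ln); last by lia.
    rewrite -(big_mkord predT
      (fun M => (Q M).[x t ^+ 2] * x t ^+ `|M - N| * w t l ^+ M)).
    rewrite (@big_cat_nat _ _ _ t.*2) //=; last by lia.
    rewrite [X in _ = X + _]big1_seq => [|M' /=]; last first.
      rewrite mem_index_iota => M't.
      rewrite (few_roots t M') ?horner0 ?mul0r //; try by lia.
      by move=> s st; apply: IH => //; lia.
    rewrite add0r (@big_cat_nat _ _ _ (N.*2.+1 - t.*2)) //=; try by lia.
    rewrite [X in _ = _ + X]big1_seq => [|M' /=]; last first.
      rewrite mem_index_iota => M't.
      rewrite (few_roots t M') ?horner0 ?mul0r //; try by lia.
      by move=> s st; apply: IH => //; lia.
    rewrite addr0 -[X in index_iota X _]add0n big_addn big_mkord mulr_sumr.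
    have -> : (N.*2.+1 - t.*2 - t.*2 = N.*2.+1 - t.*2.*2)%N by lia.
    by apply: eq_bigr => k _; rewrite /c exprD addnC; ring.
  move: cM; rewrite /c subnKC; last by lia.
  move/eqP; rewrite mulf_eq0 => /orP[/eqP //|]; rewrite expf_eq0 => /andP[].
  (* A positive exponent [|M - N|] forces [2 t < N], so [x t] is nonzero. On a circle of radius 0
     only [M = N] survives, with exponent 0. *)
  move=> d0; have tN' : (t.*2 < N)%N by lia.
  by rewrite (negPf (xn0 _ tN')).
(* After [N./2 + 1] circles [2 t] exceeds [N], so no frequency is left. *)
move=> M MN; apply: (few_roots (N./2).+1) => //; try by lia.
by move=> s sN; apply: (all_roots (N./2).+1) => //; lia.
Qed.

(** * Zernike polynomials in the complex variable *)

Section Polar.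
Variable R : realType.
Implicit Types (r : R) (z : R[i]).

Lemma real_complexX r n : (r ^+ n)%:C = r%:C ^+ n.
Proof. exact: rmorphXn. Qed.

Lemma expiD (t u : R) : expi (t + u) = expi t * expi u.
Proof. by rewrite /expi cosD sinD [X in _ +i* X]addrC. Qed.

Lemma expi0 : expi 0 = 1 :> R[i].
Proof. by rewrite /expi cos0 sin0. Qed.

Lemma expi_natmul n (t : R) : expi (n%:R * t) = expi t ^+ n.
Proof.
elim: n => [|n IH]; first by rewrite mul0r expi0.
by rewrite -natr1 mulrDl mul1r expiD IH exprSr.
Qed.

Lemma expiN (t : R) : expi (- t) = (expi t)^*%R.
Proof. by rewrite /expi cosN sinN. Qed.

Lemma expi_conj (t : R) : expi t * (expi t)^*%R = 1.
Proof. by rewrite -expiN -expiD subrr expi0. Qed.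

Lemma expi_neq0 (t : R) : expi t != 0.
Proof.
by apply/eqP => t0; have := expi_conj t; rewrite t0 mul0r => /esym/eqP;
   rewrite oner_eq0.
Qed.

(** [cos t = 1 - 2 sin^2 (t / 2)], and [sin (t / 2) > 0] for [0 < t < 2 pi]. *)
Lemma expi_eq1 (t : R) : 0 <= t < 2 * pi -> expi t = 1 -> t = 0.
Proof.
move=> /andP[t0 t2] [cost _]; apply/eqP/negPn/negP => tn0.
have : 0 < sin (t / 2) by apply: sin_gt0_pi; lra.
have := cos_mulr2n (t / 2).
have -> : t / 2 *+ 2 = t by field.
rewrite cost cos2sin2.
move: (sin _) => s; nra.
Qed.

(** The quotient of two values is [expi (2 pi d / n)] with [0 <= d < n], which is 1 only for
    [d = 0]. *)
Lemma expi_inj alpha n : {in gtn n &,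
  injective (fun l => expi (alpha + 2 * pi * l%:R / n%:R) : R[i])}.
Proof.
suff H l l' : (l <= l')%N -> (l' < n)%N ->
    expi (alpha + 2 * pi * l%:R / n%:R) = expi (alpha + 2 * pi * l'%:R / n%:R) ->
    l = l'.
  move=> l l'; rewrite !inE => ln ln' e.
  by have [ll'|/ltnW ll'] := leqP l l'; [apply: H|apply/esym; apply: H].
move=> ll' ln; have n0 : 0 < n%:R :> R by rewrite ltr0n; lia.
set d := (l' - l)%N.
have -> : alpha + 2 * pi * l'%:R / n%:R
        = alpha + 2 * pi * l%:R / n%:R + 2 * pi * d%:R / n%:R.
  by rewrite /d natrB //; ring.
rewrite [X in _ = X]expiD => /esym e.
have e1 : expi (2 * pi * d%:R / n%:R : R) = 1.
  apply: (mulfI (expi_neq0 (alpha + 2 * pi * l%:R / n%:R))).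
  by rewrite mulr1.
have pi0 := @pi_gt0 R.
have range_d : 0 <= 2 * (pi : R) * d%:R / n%:R < 2 * pi.
  rewrite divr_ge0 ?mulr_ge0 ?ler0n ?(ltW pi0) //=.
  by rewrite ltr_pdivrMr // ltr_pM2l ?ltr_nat //; [rewrite /d; lia|lra].
have /eqP := expi_eq1 range_d e1.
rewrite !mulf_eq0 invr_eq0 (gt_eqF pi0) (gt_eqF n0) !pnatr_eq0 /= orbF.
by rewrite /d => /eqP; lia.
Qed.

(** Agrees with the integer power on the unit circle; conjugates in place of inverses keep it a
    polynomial in [z] and its conjugate. *)
Definition zpow (m : int) z : R[i] :=
  if 0 <= m then z ^+ `|m|%N else (z^*%R) ^+ `|m|%N.

Lemma expi_int m (t : R) : expi (m%:~R * t) = zpow m (expi t).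
Proof.
rewrite /zpow; case: m => n; first by rewrite -expi_natmul.
by rewrite NegzE mulrNz mulNr expiN -rmorphXn -expi_natmul.
Qed.

Lemma zpow_polar m r (t : R) :
  r%:C ^+ `|m| * expi (m%:~R * t) = zpow m (r%:C * expi t).
Proof.
rewrite expi_int /zpow; case: ifP => _; first by rewrite exprMn.
by rewrite rmorphM exprMn; congr (_ ^+ _ * _); apply/esym/conjc_real.
Qed.

(* [radial n a r] is [r ^+ a] times this polynomial at [r ^+ 2]; the sum runs
   over k = (n - a) / 2 - s. *)
Definition radial_poly (n a : nat) : {poly R[i]} :=
  \poly_(k < ((n - a)./2).+1)
    ((-1) ^+ ((n - a)./2 - k) * ((n - ((n - a)./2 - k))`!)%:R
     / (((n - a)./2 - k)`! * ((n + a)./2 - ((n - a)./2 - k))`! * k`!)%:R : R)%:C.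

Lemma size_radial_poly n a : size (radial_poly n a) = ((n - a)./2).+1.
Proof.
apply: size_poly_eq; rewrite subnn subn0 expr0 mul1r fmorph_eq0.
by rewrite mulf_neq0 ?invr_eq0 ?pnatr_eq0 -?lt0n ?muln_gt0 ?fact_gt0.
Qed.

Lemma radialE n a r : (a <= n)%N -> ~~ odd (n - a) ->
  (radial n a r)%:C = r%:C ^+ a * (radial_poly n a).[r%:C ^+ 2].
Proof.
move=> an ev; rewrite horner_poly (reindex_inj rev_ord_inj) /= mulr_sumr.
rewrite rmorph_sum; apply: eq_bigr => /= -[s sn] _ /=.
rewrite subSS subKn // rmorphM /= real_complexX mulrCA -exprM -exprD.
by congr (_ * _ ^+ _); lia.
Qed.

Definition zernike_norm (n : nat) : R[i] := (Num.sqrt (n.+1%:R / pi : R))%:C.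

Lemma zernike_norm_neq0 n : zernike_norm n != 0.
Proof.
by rewrite fmorph_eq0 gt_eqF // sqrtr_gt0 divr_gt0 ?pi_gt0 ?ltr0n.
Qed.

(** The Zernike polynomial in [z = r e^(i phi)], free of the choice of an angle. *)
Definition zernikeC n m z : R[i] :=
  zernike_norm n * (radial_poly n `|m|%N).[z * z^*%R] * zpow m z.

Lemma zernike_polar n a r (t : R) : (a <= n)%N ->
  zernike n (a.*2%:Z - n%:Z) r t = zernikeC n (a.*2%:Z - n%:Z) (r%:C * expi t).
Proof.
move=> an; rewrite /zernike /zernikeC -zpow_polar rmorphM /=.
rewrite radialE; try by lia.
have -> : r%:C * expi t * (r%:C * expi t)^*%R = r%:C ^+ 2.
  rewrite rmorphM mulrACA expi_conj mulr1 expr2; congr (_ * _).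
  exact: conjc_real.
by rewrite /zernike_norm; ring.
Qed.

(* Multiplying by [expi t ^+ N] makes all the angular exponents natural. *)
Lemma zernike_shift N n a r (t : R) : (a <= n)%N -> (n <= N)%N ->
  zernike n (a.*2%:Z - n%:Z) r t * expi t ^+ N =
  zernike_norm n * (radial_poly n `|(a.*2 + N - n)%N - N|%N).[r%:C ^+ 2]
    * r%:C ^+ `|(a.*2 + N - n)%N - N|%N * expi t ^+ (a.*2 + N - n).
Proof.
move=> an nN; rewrite /zernike rmorphM /= radialE; try by lia.
have -> : `|a.*2%:Z - n%:Z|%N = `|(a.*2 + N - n)%N - N|%N by lia.
have <- : expi ((a.*2%:Z - n%:Z)%:~R * t) * expi t ^+ N
       = expi t ^+ (a.*2 + N - n).
  rewrite -!expi_natmul -expiD -mulrDl; congr (expi (_ * _)).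
  by rewrite !pmulrn -rmorphD /=; congr (_%:~R); lia.
by rewrite /zernike_norm; ring.
Qed.

(** * Positivity and monotonicity of the radii *)

(** The angle [(2 t + 1) pi / (2 (N + 1))] is below [pi / 2] when [2 t < N], and equals it when
    [2 t = N]. *)
Lemma zeta_gt0 N t : (t.*2 < N)%N -> 0 < zeta R N t.+1.
Proof.
move=> tN; have pi0 := @pi_gt0 R.
have : t.*2.+1%:R <= N%:R :> R by rewrite ler_nat.
have t0 : 0 <= t%:R :> R by rewrite ler0n.
rewrite -(natr1 t.*2) /zeta -(natr1 t) -muln2 natrM.
move: (t%:R : R) (N%:R : R) t0 => x n x0 xn.
apply: cos_gt0_pihalf; apply/andP; split.
  by rewrite (@lt_le_trans _ _ 0) ?oppr_lt0 ?divr_ge0 ?mulr_ge0 //; lra.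
rewrite ltr_pdivrMr; last by lra.
nra.
Qed.

Lemma zeta_ge0 N t : (t.*2 <= N)%N -> 0 <= zeta R N t.+1.
Proof.
rewrite leq_eqVlt => /orP[/eqP <-|/zeta_gt0/ltW //].
rewrite /zeta -muln2 natrM -(natr1 t).
have t0 : 0 <= t%:R :> R by rewrite ler0n.
have -> : (2 * (t%:R + 1) - 1) * pi / (2 * (t%:R * 2 + 1)) = pi / 2 :> R by field; lra.
by rewrite cos_pihalf.
Qed.

Lemma zeta_decreasing N s t : (s < t)%N -> (t.*2 <= N)%N ->
  zeta R N t.+1 < zeta R N s.+1.
Proof.
move=> st tN; have pi0 := @pi_gt0 R.
have {st} : s.+1%:R <= t%:R :> R by rewrite ler_nat.
have : t.*2%:R <= N%:R :> R by rewrite ler_nat.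
rewrite -muln2 natrM -(natr1 s).
have s0 : 0 <= s%:R :> R by rewrite ler0n.
rewrite /zeta -(natr1 s) -(natr1 t).
move: (s%:R : R) (t%:R : R) (N%:R : R) s0 => x y n x0 yn xy.
have n0 : 0 < 2 * (n + 1) by lra.
rewrite ltr_cos ?in_itv /=.
- by rewrite ltr_pM2r ?invr_gt0 // ltr_pM2r //; lra.
- rewrite divr_ge0 ?mulr_ge0 ?ler_pdivrMr //=; try lra.
  by rewrite [leRHS]mulrC ler_pM2r //; lra.
- rewrite divr_ge0 ?mulr_ge0 ?ler_pdivrMr //=; try lra.
  by rewrite [leRHS]mulrC ler_pM2r //; lra.
Qed.

Definition radius_cubic (x : R) : R :=
  (1 + 156 / 10 ^+ 3 + 5 / 10 ^+ 4) * x
  - (765 / 10 ^+ 3 + 35 / 10 ^+ 5) * x ^+ 2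
  + (605 / 10 ^+ 3 + 17 / 10 ^+ 5) * x ^+ 3.

Lemma radius_cubic_increasing (x y : R) :
  x < y -> radius_cubic x < radius_cubic y.
Proof.
move=> xy; rewrite -subr_gt0.
have -> : radius_cubic y - radius_cubic x
  = (y - x) * ((1 + 156 / 10 ^+ 3 + 5 / 10 ^+ 4)
               - (765 / 10 ^+ 3 + 35 / 10 ^+ 5) * (x + y)
               + (605 / 10 ^+ 3 + 17 / 10 ^+ 5) * (x ^+ 2 + x * y + y ^+ 2)).
  by rewrite /radius_cubic; field.
rewrite mulr_gt0 ?subr_gt0 //.
(* x^2 + x y + y^2 is at least 3/4 of the square of x + y, and the resulting
   quadratic polynomial in x + y has no real root. *)
have : 0 <= (x - y) ^+ 2 by exact: sqr_ge0.
have : 0 <= (x + y - 1) ^+ 2 by exact: sqr_ge0.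
have : 0 <= (x + y) ^+ 2 by exact: sqr_ge0.
rewrite !expr2; lra.
Qed.

(** [radius_cubic] increases from 0 at 0, and [lambda] is by conversion its value at [zeta]. *)
Lemma lambda_gt0 N t : (t.*2 < N)%N -> 0 < lambda R N t.+1.
Proof.
move=> /zeta_gt0/radius_cubic_increasing.
by rewrite {1}/radius_cubic !expr0n /= !mulr0 subrr addr0.
Qed.

Lemma lambda_ge0 N t : (t.*2 <= N)%N -> 0 <= lambda R N t.+1.
Proof.
move=> /zeta_ge0; rewrite le_eqVlt => /orP[/eqP z0|/radius_cubic_increasing].
  by rewrite /lambda -z0 !expr0n /= !mulr0 subrr addr0.
by rewrite {1}/radius_cubic !expr0n /= !mulr0 subrr addr0 => /ltW.
Qed.

Lemma lambda_sqr_inj N :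
  {in [pred t | t.*2 <= N]%N &, injective (fun t => lambda R N t.+1 ^+ 2)}.
Proof.
have H s t : (s < t)%N -> (t.*2 <= N)%N -> lambda R N t.+1 < lambda R N s.+1.
  by move=> st tN; apply: radius_cubic_increasing; apply: zeta_decreasing.
move=> s t /=; rewrite !inE => sN tN /eqP.
rewrite eqrXn2 ?lambda_ge0 // => /eqP e.
by have [st|ts|//] := ltngtP s t; [have := H _ _ st tN|have := H _ _ ts sN];
   rewrite e ltxx.
Qed.
End Polar.

(** * Unisolvence of the regular points *)

(* The pair (n, a) with a <= n <= N stands for the Zernike polynomial of degree
   n and angular order m = 2 a - n, and also for the monomial x^a y^(n - a). *)
Definition zidx (N : nat) : finType := {n : 'I_N.+1 & 'I_n.+1}.

Lemma zidx_inj N (p q : zidx N) :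
  tag p = tag q :> nat -> tagged p = tagged q :> nat -> p = q.
Proof.
case: p q => [n a] [n' a'] /= /val_inj nn'; case: _ / nn' a' => a' aa'.
by congr Tagged; apply: val_inj.
Qed.

Lemma sum_zidx (V : nmodType) N (F : nat -> nat -> V) :
  \sum_(p : zidx N) F (tag p) (tagged p) = \sum_(n < N.+1) \sum_(a < n.+1) F n a.
Proof. by rewrite sig_big_dep. Qed.

Lemma card_zidx N : #|zidx N| = ((N + 1) * (N + 2) %/ 2)%N.
Proof.
rewrite -sum1_card (@sum_zidx nat N (fun _ _ => 1%N)).
elim: N => [|N IH]; first by rewrite !big_ord_recl !big_ord0.
rewrite big_ord_recr -[LHS]/(_ + _)%N IH sum1_card card_ord.
have -> : ((N.+1 + 1) * (N.+1 + 2) = (N + 1) * (N + 2) + N.+2 * 2)%N by ring.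
by rewrite divnDMl.
Qed.

(** Passes from the orders [m = k - n], [0 <= k <= 2 n], of the parity of [n] to [m = 2 a - n]. *)
Lemma sum_even (V : nmodType) n (G : nat -> V) :
  \sum_(0 <= k < n.*2.+1 | ~~ odd k) G k = \sum_(a < n.+1) G a.*2.
Proof.
elim: n => [|n IH]; first by rewrite big_mkcond big_nat1 big_ord1.
rewrite [RHS]big_ord_recr /= -IH doubleS big_mkcond.
by rewrite big_nat_recr //= big_nat_recr //= -big_mkcond /= odd_double /= addr0.
Qed.

(** The shifted frequency determines [m]; since [n - |m|] is even, its half then determines [n], and
    so [a]. *)
Lemma degree_angular_radial_inj N n a n' a' : (a <= n)%N -> (a' <= n')%N -> (n <= N)%N ->
  (n' <= N)%N -> (a.*2 + N - n = a'.*2 + N - n')%N ->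
  ((n - `|(a.*2 + N - n)%N - N|)./2 = (n' - `|(a.*2 + N - n)%N - N|)./2)%N ->
  n = n' /\ a = a'.
Proof. by lia. Qed.

Section Unisolvence.
Variable R : realType.

Definition zernike_at N (p : zidx N) (r phi : R) : R[i] :=
  zernike (tag p) ((tagged p).*2%:Z - (tag p)%:Z) r phi.

Lemma kernel_polyE N (r phi rho theta : R) :
  kernel_poly N r phi rho theta =
  \sum_(p : zidx N) (zernike_at p rho theta)^*%R * zernike_at p r phi.
Proof.
rewrite (@sum_zidx _ N (fun n a => (zernike n (a.*2%:Z - n%:Z) rho theta)^*%R
   * zernike n (a.*2%:Z - n%:Z) r phi)) /kernel_poly big_mkord.
apply: eq_bigr => n _; rewrite /sym_range big_map.
rewrite -(@sum_even _ n (fun k => (zernike n (k%:Z - n%:Z) rho theta)^*%R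
   * zernike n (k%:Z - n%:Z) r phi)) /index_iota subn0.
by apply: eq_bigl => k; lia.
Qed.

Lemma polarE (r phi : R) :
  r%:C * expi phi = (cartesian r phi).1 +i* (cartesian r phi).2.
Proof. by apply/eqP; rewrite eq_complex /= !mul0r subr0 addr0 !eqxx. Qed.

Lemma zernike_atE N (p : zidx N) (r phi : R) :
  zernike_at p r phi =
  zernikeC (tag p) ((tagged p).*2%:Z - (tag p)%:Z) (r%:C * expi phi).
Proof. by apply: zernike_polar; rewrite -ltnS. Qed.

Lemma zernike_unisolvent N J (rho theta : 'I_J -> R) :
  regular_points N rho theta ->
  forall v : zidx N -> R[i],
  (forall j, \sum_p v p * zernike_at p (rho j) (theta j) = 0) ->
  forall p, v p = 0.
Proof.
move=> [_ _ _ [alpha range_eq]] v sum0.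
pose h (p : zidx N) := ((tagged p).*2 + N - tag p)%N.
have tag_lt (p : zidx N) : (tag p <= N)%N by rewrite -ltnS.
have tagged_lt (p : zidx N) : (tagged p <= tag p)%N by rewrite -ltnS.
have h_lt p : (h p < N.*2.+1)%N.
  by have := tag_lt p; have := tagged_lt p; rewrite /h; lia.
(* [h p] is [N + m], so [Q M] gathers the radial parts of order [m = M - N]. *)
pose Q M := \sum_(p : zidx N | h p == M)
  (v p * zernike_norm R (tag p)) *: radial_poly R (tag p) `|M - N|%N.
have Q0 M : (M <= N.*2)%N -> Q M = 0.
  (* Here [t] counts circles from 0, whereas the radii are numbered from 1. *)
  apply: (@circles_unisolvent _ N Q (fun t => (lambda R N t.+1)%:C)
    (fun t l => expi (alpha t.+1 + 2 * pi * l%:R / (N.*2.+1 - t.*2.*2)%:R))).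
  - move=> M' _; apply: (leq_trans (size_sum _ _ _)); apply/bigmax_leqP => p _.
    apply: (leq_trans (size_scale_leq _ _)); rewrite size_radial_poly ltnS.
    by apply: half_leq; apply: leq_sub2r.
  - move=> s t sN tN; rewrite -!real_complexX => /complexI.
    exact: lambda_sqr_inj.
  - by move=> t tN; rewrite fmorph_eq0 gt_eqF ?lambda_gt0.
  - by move=> t tN; apply: expi_inj.
  - by move=> t l; apply: expi_neq0.
  - move=> t l tN ln.
    set phi := (X in expi X).
    have [j _ ej] : range (fun j => cartesian (rho j) (theta j))
        (cartesian (lambda R N t.+1) phi).
      rewrite range_eq; exists t.+1, l; rewrite /nb_circles /nb_points.
      have e : (2 * N + 5 - 4 * t.+1 = N.*2.+1 - t.*2.*2)%N by lia.
      by split; rewrite ?e //; lia.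
    have := congr1 (fun y => y * expi phi ^+ N) (sum0 j).
    rewrite mul0r mulr_suml => e0; rewrite -[RHS]e0.
    rewrite [RHS](partition_big (fun p => Ordinal (h_lt p)) predT) //=.
    apply: eq_bigr => M' _; rewrite /Q horner_sum !mulr_suml.
    apply: eq_big => [p //|p /eqP hp].
    (* The two polar forms of the point may differ; only [z] is known to be the same. *)
    rewrite -[RHS]mulrA zernike_atE polarE ej -polarE -zernike_atE.
    rewrite /zernike_at zernike_shift //; move: hp; rewrite /h => ->.
    by rewrite hornerZ; ring.
move=> p.
suff /eqP : v p * zernike_norm R (tag p) = 0.
  by rewrite mulf_eq0 (negPf (zernike_norm_neq0 _ _)) orbF => /eqP.
have QM0 : Q (h p) = 0 by apply: Q0; rewrite -ltnS.
apply: (distinct_sizes_free _ _ QM0) => // [q /eqP <-|q q'].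
  by rewrite -size_poly_gt0 size_radial_poly.
rewrite /in_mem /= !size_radial_poly => /eqP hq /eqP hq' [].
rewrite -hq in hq' *; rewrite /h => sz.
have [] := degree_angular_radial_inj (tagged_lt q) (tagged_lt q') 
  (tag_lt q) (tag_lt q') (esym hq') sz.
exact: zidx_inj.
Qed.
End Unisolvence.

(** * Polynomial functions on the disk *)

Section PolynomialFunctions.
Variable R : realType.

Lemma polar_angleK (p : R * R) : cartesian (polar_radius p) (polar_angle p) = p.
Proof.
(* Existence of an angle excludes the default value of [xget]. *)
suff : exists phi, 0 <= phi < 2 * pi /\ p = cartesian (polar_radius p) phi.
  by move=> [phi H]; rewrite /polar_angle; case: xgetP => [y _ []//|/(_ phi)].
rewrite /polar_radius; case: p => x y /=; set r := Num.sqrt _.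
have pi0 := @pi_gt0 R.
have sq_ge0 : 0 <= x ^+ 2 + y ^+ 2 by rewrite addr_ge0 ?sqr_ge0.
have r2 : r ^+ 2 = x ^+ 2 + y ^+ 2 by rewrite sqr_sqrtr.
have [r0|rn0] := eqVneq r 0.
  exists 0; rewrite lexx mulr_gt0 //; split=> //.
  rewrite /cartesian r0 !mul0r; move/eqP: r2; rewrite r0 expr0n /= eq_sym.
  by rewrite paddr_eq0 ?sqr_ge0 // !sqrf_eq0 => /andP[/eqP -> /eqP ->].
have r_gt0 : 0 < r by rewrite lt_def rn0 sqrtr_ge0.
have xr : -1 <= x / r <= 1.
  rewrite ler_pdivlMr // ler_pdivrMr //.
  have y2 := sqr_ge0 y; rewrite mulN1r mul1r; apply/andP; split; nra.
have sinE : r * sin (acos (x / r)) = `|y|.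
  have yr : 1 - (x / r) ^+ 2 = (y / r) ^+ 2.
    have y2 : y ^+ 2 = r ^+ 2 - x ^+ 2 by rewrite r2 addrC addKr.
    by rewrite [RHS]expr_div_n y2; field.
  rewrite sin_acos // yr sqrtr_sqr normrM normfV (gtr0_norm r_gt0).
  by rewrite mulrC divfK.
have cosE : r * cos (acos (x / r)) = x by rewrite acosK ?in_itv //= mulrC divfK.
have acos0 := acos_ge0 xr; have acos_pi := acos_lepi xr.
have [y0|y0] := leP 0 y.
  exists (acos (x / r)); split; first by apply/andP; split=> //; lra.
  by rewrite /cartesian cosE sinE ger0_norm.
(* Lower half plane: [y < 0] makes [acos (x / r)] nonzero, which keeps the angle below [2 pi]. *)
exists (2 * pi - acos (x / r)).
have acos_n0 : acos (x / r) != 0.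
  apply/eqP => a0; move: sinE; rewrite a0 sin0 mulr0 => /esym/eqP.
  by rewrite normr_eq0 lt_eqF.
split; first by have := lt_def 0 (acos (x / r)); rewrite acos_n0 acos0 /=; lra.
rewrite /cartesian (mulr_natl pi 2) addrC cosD2pi sinD2pi cosN sinN mulrN cosE sinE.
by rewrite ltr0_norm ?opprK.
Qed.

Definition disk_point (p : disk R) : R[i] := (sval p).1 +i* (sval p).2.

Lemma on_diskE (F : R -> R -> R[i]) (G : R[i] -> R[i]) :
  (forall r phi, F r phi = G (r%:C * expi phi)) ->
  forall p, on_disk F p = G (disk_point p).
Proof. by move=> FG p; rewrite /on_disk FG polarE polar_angleK. Qed.

(** * Closure properties of the polynomial spaces *)

Lemma VN_mono M N (f : disk R -> R[i]^o) : (M <= N)%N -> VN R M f -> VN R N f.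
Proof. by move=> MN [q sq qf]; exists q => //; apply: leq_trans sq _. Qed.

Lemma VN_ext N (f g : disk R -> R[i]^o) : f =1 g -> VN R N f -> VN R N g.
Proof. by move=> fg [q sq qf]; exists q => // p; rewrite -fg. Qed.

Lemma VN_const (c : R[i]) : VN R 0 (fun _ => c).
Proof.
exists (mpoly.mpolyC 2 c) => [|p]; last by rewrite mpoly.mevalC.
by rewrite mpoly.msizeC leq_b1.
Qed.

Lemma VN_coord (i : 'I_2) :
  VN R 1 (fun p => (if i == 0 then (sval p).1 else (sval p).2)%:C).
Proof.
exists (mpoly.mpolyX _ (mpoly.mnm1 i)) => [|p].
  by rewrite mpoly.msizeX mpoly.mdeg1.
by rewrite mpoly.mevalXU.
Qed.

Lemma VN_add N (f g : disk R -> R[i]^o) :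
  VN R N f -> VN R N g -> VN R N (fun p => f p + g p).
Proof.
move=> [q sq qf] [q' sq' qf']; exists (q + q') => [|p].
  by apply: leq_trans (mpoly.msizeD_le _ _) _; rewrite geq_max sq.
by rewrite qf qf' mpoly.mevalD.
Qed.

Lemma VN_mul M N (f g : disk R -> R[i]^o) :
  VN R M f -> VN R N g -> VN R (M + N) (fun p => (f p : R[i]) * g p).
Proof.
move=> [q sq qf] [q' sq' qf']; exists (q * q') => [|p].
  (* The formula for [msize] of a product holds for nonzero factors only. *)
  have [->|q0] := eqVneq q 0; first by rewrite mul0r mpoly.msize0.
  have [->|q'0] := eqVneq q' 0; first by rewrite mulr0 mpoly.msize0.
  rewrite mpoly.msizeM // -subn1.
  by apply: leq_trans (leq_sub2r 1 (leq_add sq sq')) _; lia.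
by rewrite qf qf' mpoly.mevalM.
Qed.

Lemma VN_exp N n (f : disk R -> R[i]^o) :
  VN R N f -> VN R (n * N) (fun p => (f p : R[i]) ^+ n).
Proof.
move=> Vf; elim: n => [|n IH]; first exact: VN_const.
by rewrite mulSn; apply: VN_ext (VN_mul Vf IH) => p; rewrite exprS.
Qed.

Lemma VN_sum N (I : Type) (s : seq I) (P : pred I) (f : I -> disk R -> R[i]^o) :
  (forall i, P i -> VN R N (f i)) -> VN R N (fun p => \sum_(i <- s | P i) f i p).
Proof.
move=> Vf; elim: s => [|i s IH].
  apply: VN_ext (VN_mono (leq0n N) (VN_const 0)) => p.
  by rewrite big_nil.
have [Pi|Pi] := boolP (P i); last first.
  by apply: VN_ext IH => p; rewrite big_cons (negPf Pi).
by apply: VN_ext (VN_add (Vf i Pi) IH) => p; rewrite big_cons Pi.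
Qed.

Lemma VN_disk_point : VN R 1 disk_point.
Proof.
apply: VN_ext (VN_add (VN_coord 0) (VN_mul (VN_const 'i) (VN_coord 1))) => p.
by rewrite /disk_point [RHS]complexE.
Qed.

Lemma VN_disk_point_conj : VN R 1 (fun p => (disk_point p)^*%R).
Proof.
apply: VN_ext (VN_add (VN_coord 0) (VN_mul (VN_const (- 'i)) (VN_coord 1))) => p.
rewrite /disk_point.
by rewrite [RHS]complexE /= rmorphN /= mulrN mulNr.
Qed.

(** The radial factor has degree at most [n - |m|] in the coordinates and [zpow] at most [|m|], in
    total [n <= N]. *)
Lemma VN_zernike N (q : zidx N) :
  VN R N (fun p => zernikeC (tag q) ((tagged q).*2%:Z - (tag q)%:Z) (disk_point p)).
Proof.
have tag_lt : (tag q <= N)%N by rewrite -ltnS.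
have tagged_lt : (tagged q <= tag q)%N by rewrite -ltnS.
set n := nat_of_ord (tag q) in tag_lt tagged_lt *.
set m := _ - _; have m_le : (`|m| <= n)%N by rewrite /m; lia.
have Vpow : VN R (`|m| * 1)%N (fun p => zpow m (disk_point p)).
  rewrite /zpow; case: (0 <= m).
    exact: VN_exp VN_disk_point.
  exact: VN_exp VN_disk_point_conj.
have Vrad : VN R (n - `|m|)%N
    (fun p => (radial_poly R n `|m|%N).[disk_point p * (disk_point p)^*%R]).
  pose c i := (radial_poly R n `|m|%N)`_i.
  apply: (@VN_ext _ (fun p => \sum_(i < ((n - `|m|)./2).+1)
     c i * (disk_point p * (disk_point p)^*%R) ^+ i)) => [p|].
    by rewrite horner_coef size_radial_poly.
  apply: VN_sum => i _.
  have := VN_mul (VN_const (c i))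
    (VN_exp i (VN_mul VN_disk_point VN_disk_point_conj)).
  by apply: VN_mono; have := ltn_ord i; lia.
have := VN_mul (VN_mul (VN_const (zernike_norm R n)) Vrad) Vpow.
by apply: VN_mono; lia.
Qed.

Definition monomial_fun N (q : zidx N) (p : disk R) : R[i] :=
  (sval p).1%:C ^+ tagged q * (sval p).2%:C ^+ (tag q - tagged q).

Lemma VN_monomials N (f : disk R -> R[i]^o) : VN R N f ->
  exists c : zidx N -> R[i], forall p, f p = \sum_q c q * monomial_fun q p.
Proof.
move=> [q sq qf].
suff [c cE] : exists c : zidx N -> R[i], forall p : disk R,
    \sum_(m <- mpoly.msupp q) mpoly.mcoeff m q *
      \prod_(i < 2) (if i == 0 then (sval p).1 else (sval p).2)%:C ^+ m i
    = \sum_q c q * monomial_fun q p.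
  by exists c => p; rewrite qf mpoly.mevalE cE.
have : {subset mpoly.msupp q <= [pred m | mpoly.mdeg m <= N]%N}.
  by move=> m /mpoly.msize_mdeg_lt mq; rewrite inE -ltnS (leq_trans mq).
elim: (mpoly.msupp q) => [|m s IH] sub.
  exists (fun=> 0) => p; rewrite big_nil big1 // => i _; exact: mul0r.
have [i|c cE] := IH; first by move=> si; apply: sub; rewrite in_cons si orbT.
have := sub m (mem_head _ _); rewrite inE mpoly.mdegE big_ord_recl big_ord1 => deg_m.
set a := m ord0 in deg_m; set b := m (lift ord0 ord0) in deg_m.
have ltN : (a + b < N.+1)%N by [].
have ltn : (a < (Ordinal ltN).+1)%N by rewrite ltnS leq_addr.
(* The index of [x^a y^b] has degree component [a + b]. *)
pose k : zidx N := Tagged (fun n : 'I_N.+1 => 'I_n.+1) (Ordinal ltn).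
exists (fun j => c j + (j == k)%:R * mpoly.mcoeff m q) => p.
rewrite big_cons cE addrC.
under [RHS]eq_bigr do rewrite mulrDl.
rewrite big_split /=; congr (_ + _).
rewrite [RHS](bigD1 k) // eqxx mul1r [X in _ = _ + X]big1 => [|j jk]; last first.
  by rewrite (negPf jk) !mul0r.
by rewrite addr0 big_ord_recl big_ord1 /= /monomial_fun /= addKn.
Qed.
End PolynomialFunctions.

(** * The kernel polynomials as a basis *)

Lemma kernel_polyC (R : realType) N (r phi rho theta : R) :
  kernel_poly N r phi rho theta =
  \sum_(q : zidx N) (zernike_at q rho theta)^*%R
    * zernikeC (tag q) ((tagged q).*2%:Z - (tag q)%:Z) (r%:C * expi phi).
Proof.
by rewrite kernel_polyE; apply: eq_bigr => q _; rewrite [X in _ * X]zernike_atE.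
Qed.

Lemma cartesian_in_disk (R : realType) (r phi : R) : 0 <= r <= 1 ->
  (cartesian r phi).1 ^+ 2 + (cartesian r phi).2 ^+ 2 <= 1.
Proof.
move=> /andP[r0 r1] /=; rewrite !exprMn -mulrDr cos2Dsin2 mulr1.
by rewrite expr_le1.
Qed.

Theorem theorem2p6 (R : realType) (N J : nat) (rho theta : 'I_J -> R)
  (hN : (1 <= N)%N) (hJ : J = (((N + 1) * (N + 2)) %/ 2)%N)
  (hP : regular_points N rho theta) :
  is_basis (VN R N)
    (fun j : 'I_J =>
       on_disk (fun r phi => kernel_poly N r phi (rho j) (theta j)))
  /\
  is_basis (VN R N) (fun j : 'I_J => on_disk (scaling_fun N rho theta j)).
Proof.
(* The two families are convertible by unfolding [scaling_fun]. *)
suff H : is_basis (VN R N) (fun j : 'I_J =>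
    on_disk (fun r phi => kernel_poly N r phi (rho j) (theta j))) by split.
have cardJ : #|zidx N| = #|'I_J| by rewrite card_ord hJ card_zidx.
have unisolv := zernike_unisolvent hP.
set K := fun j : 'I_J => _.
have KE j p : K j p = \sum_(q : zidx N) (zernike_at q (rho j) (theta j))^*%R
    * zernikeC (tag q) ((tagged q).*2%:Z - (tag q)%:Z) (disk_point p).
  pose G z := \sum_(q : zidx N) (zernike_at q (rho j) (theta j))^*%R
    * zernikeC (tag q) ((tagged q).*2%:Z - (tag q)%:Z) z.
  by rewrite /K (@on_diskE _ _ G) // => r phi; apply: kernel_polyC.
have VK j : VN R N (K j).
  apply: (VN_ext (fun p => esym (KE j p))); apply: VN_sum => q _.
  exact: VN_mul (VN_const _) (VN_zernike R q).
have freeK (c : 'I_J -> R[i]) : \sum_(j < J) c j *: K j = 0 -> forall j, c j = 0.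
  move=> sum0.
  (* These sums are the Zernike coefficients of the combination, which is zero at every point;
     unisolvence makes them vanish. *)
  have S0 (q : zidx N) : \sum_j c j * (zernike_at q (rho j) (theta j))^*%R = 0.
    move: q; apply: unisolv => i.
    have [rho_in _ _ _] := hP.
    pose p : disk R := exist _ (cartesian (rho i) (theta i))
      (cartesian_in_disk (theta i) (rho_in i)).
    have := congr1 (fun f : disk R -> R[i]^o => f p) sum0.
    rewrite fct_sumE => e0; rewrite -[RHS]e0.
    under [RHS]eq_bigr => j _.
      rewrite -[(c j *: K j) p]/(c j * K j p) KE mulr_sumr; over.
    rewrite exchange_big; apply: eq_bigr => q _; rewrite mulr_suml.
    apply: eq_bigr => j _.
    by rewrite (zernike_atE q (rho i)) polarE [RHS]mulrA.
  have [B [_ BA]] := left_injective_two_sided_inverse cardJ unisolv.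
  (* [B] inverts the matrix of Zernike values, while [S0] has their conjugates: hence the conjugate
     of [c j]. *)
  move=> j; apply/eqP; rewrite -conjC_eq0; apply/eqP.
  transitivity (\sum_i (\sum_q B j q * zernike_at q (rho i) (theta i)) * (c i)^*%R).
    rewrite (bigD1 j) //= BA eqxx mul1r big1 ?addr0 // => i ij.
    by rewrite BA eq_sym (negPf ij) mul0r.
  under eq_bigr do rewrite mulr_suml.
  rewrite exchange_big big1 // => q _.
  transitivity (B j q * (\sum_i c i * (zernike_at q (rho i) (theta i))^*%R)^*%R).
    rewrite rmorph_sum mulr_sumr; apply: eq_bigr => i _.
    have conjM (x y : R[i]) : (x * y^*%R)^*%R = y * x^*%R.
      by rewrite rmorphM [LHS]mulrC; congr (_ * _); apply: conjCK.
    by rewrite -[LHS]mulrA -[in LHS]conjM.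
  by rewrite S0 rmorph0 mulr0.
split=> // v /VN_monomials[d vE].
have [m KM] := choice (fun j => VN_monomials (VK j)).
(* Independence of the kernels makes their square matrix of monomial coefficients invertible. *)
have [||B [_ BM]] := @left_injective_two_sided_inverse _ _ _ m.
- by rewrite -cardJ.
- move=> c c0; apply: freeK; apply: funext => p; rewrite fct_sumE.
  under eq_bigr => j _.
    rewrite -[(c j *: K j) p]/(c j * K j p) KM mulr_sumr; over.
  rewrite exchange_big big1 // => q _.
  transitivity ((\sum_j c j * m j q) * monomial_fun q p).
    by rewrite mulr_suml; apply: eq_bigr => j _; rewrite mulrA.
  by rewrite c0 mul0r.
(* Row [q] of [B] expands the monomial [q] in the kernels. *)
exists (fun j => \sum_q d q * B q j); apply: funext => p.
rewrite vE fct_sumE.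
under [RHS]eq_bigr => j _.
  rewrite -[(_ *: K j) p]/((\sum_q d q * B q j) * K j p) mulr_suml; over.
rewrite exchange_big; apply: eq_bigr => q _.
under eq_bigr do rewrite -mulrA KM mulr_sumr.
rewrite -mulr_sumr exchange_big; congr (_ * _).
under eq_bigr => q' _ do under eq_bigr do rewrite mulrA.
under eq_bigr => q' _ do rewrite -mulr_suml BM.
rewrite (bigD1 q) //= eqxx mul1r big1 ?addr0 // => q' /negPf qq'.
by rewrite eq_sym qq' mul0r.
Qed.
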